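(* Let $O$ be an operator on $\mathcal{H}=(\mathbb{C}^2)^{\otimes n}$ with spectral norm $\|O\|$, and let $\lambda$ be such that $\langle \mathbb{1}\rangle(\lambda)>0$. Let $\varepsilon>0$ and $\kappa>0$. Suppose both estimators $\hat{\langle O\rangle}$ and $\hat{\langle \mathbb{1}\rangle}$ are computed with sample size $M$ satisfying $$M\ge \frac{\chi^2}{\kappa\,\varepsilon^2\,\langle \mathbb{1}\rangle(\lambda)^2},\qquad \chi=\sqrt{\|O\|^2+\sigma_O^2}+\sqrt{1+\sigma_{\mathbb{1}}^2}\,\|O\|+\varepsilon\sqrt{1+\sigma_{\mathbb{1}}^2}.$$ Then $$\Pr\left(\left|\frac{\hat{\langle O\rangle}}{\hat{\langle \mathbb{1}\rangle}}-\widetilde{\langle O\rangle}(\lambda)\right|\le\varepsilon\right)\ge 1-2\kappa .$$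
   Context: Setting (variational quantum-circuit Monte Carlo). Fix $n$ qubits with Hilbert space $\mathcal{H}=(\mathbb{C}^2)^{\otimes n}$. A parameterised circuit gives normalised states $|\phi(\theta)\rangle=U(\theta)|0\rangle^{\otimes n}$, $\theta\in\Theta\subseteq\mathbb{R}^K$, with $U(\theta)$ unitary. A complex-valued guiding function $\alpha(\theta;\lambda)$ depends on parameters $\lambda$; let $C(\lambda)=\int_\Theta|\alpha(\theta;\lambda)|\,d\theta$ (finite and positive), $P(\theta;\lambda)=|\alpha(\theta;\lambda)|/C(\lambda)$ (a probability density), and $e^{i\gamma(\theta;\lambda)}=\alpha(\theta;\lambda)/|\alpha(\theta;\lambda)|$. The (unnormalised) variational state is $|\psi(\lambda)\rangle=\int_\Theta P(\theta;\lambda)e^{i\gamma(\theta;\lambda)}|\phi(\theta)\rangle\,d\theta$. For an operator $O$, $\langle O\rangle(\lambda)=\langle\psi(\lambda)|O|\psi(\lambda)\rangle$ and $\widetilde{\langle O\rangle}(\lambda)=\langle O\rangle(\lambda)/\langle \mathbb{1}\rangle(\lambda)$, where $\mathbb{1}$ is the identity. Estimator: for $\theta,\theta'\in\Theta$ let $X_{\theta,\theta'}=e^{i[\gamma(\theta;\lambda)-\gamma(\theta';\lambda)]}\langle\phi(\theta')|O|\phi(\theta)\rangle$. It is assumed that for each pair $(\theta,\theta')$ a (quantum measurement) procedure outputs a random variable $\hat X_{\theta,\theta'}$ that is an unbiased estimator of $X_{\theta,\theta'}$ with variance $\mathbb{E}|\hat X_{\theta,\theta'}-X_{\theta,\theta'}|^2\le\sigma_O^2$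 for all $\theta,\theta'$. The estimator $\hat{\langle O\rangle}$ with sample size $M$ draws $M$ independent pairs $(\theta_l,\theta_l')$ from the density $P(\theta;\lambda)P(\theta';\lambda)$, obtains independent $\hat X_{\theta_l,\theta_l'}$, and outputs their average $\frac1M\sum_{l=1}^M\hat X_{\theta_l,\theta'_l}$. The estimator $\hat{\langle \mathbb{1}\rangle}$ is the same construction for $O=\mathbb{1}$, with per-pair variance bound $\sigma_{\mathbb{1}}^2$. *)

(* Defs.v *)
From HB Require Import structures.
From mathcomp Require Import all_boot all_order all_algebra.
From mathcomp Require Import complex spectral.
From mathcomp Require Import all_classical all_reals all_analysis.

Set Implicit Arguments.
Unset Strict Implicit.
Unset Printing Implicit Defensive.

Import Order.TTheory GRing.Theory Num.Theory.
Local Open Scope classical_set_scope.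
Local Open Scope ring_scope.

Definition csq (R : realType) (z : R[i]) : R :=
  complex.Re z ^+ 2 + complex.Im z ^+ 2.
Definition cabs (R : realType) (z : R[i]) : R := Num.sqrt (csq z).

Definition expi (R : realType) (t : R) : R[i] := Complex (cos t) (sin t).

(* a measurement outcome in C, encoded as (real part, imaginary part) in R*R *)
Definition ctop (R : realType) (y : (R * R)%type) : R[i] := Complex y.1 y.2.

Definition adjmx (R : realType) m k (A : 'M[R[i]]_(m, k)) : 'M[R[i]]_(k, m) :=
  (map_mx Num.conj A)^T.

Definition vnorm (R : realType) N (v : 'cV[R[i]]_N) : R :=
  Num.sqrt (\sum_(j < N) csq (v j 0)).

Definition opnorm (R : realType) N (O : 'M[R[i]]_N) : R :=
  sup [set vnorm (O *m v) | v in [set v : 'cV[R[i]]_N | vnorm v = 1]].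

Definition ket0 (R : realType) (n : nat) : 'cV[R[i]]_(2 ^ n) :=
  \col_(j < 2 ^ n) (if val j == 0%N then 1 else 0).

Definition phi (R : realType) (n : nat) (Theta : Type)
  (U : Theta -> 'M[R[i]]_(2 ^ n)) (th : Theta) : 'cV[R[i]]_(2 ^ n) :=
  U th *m ket0 R n.

Definition Xpair (R : realType) N (Theta : Type) (gamma : Theta -> R)
  (ph : Theta -> 'cV[R[i]]_N) (O : 'M[R[i]]_N) (z : (Theta * Theta)%type) : R[i] :=
  expi (gamma z.1 - gamma z.2) * (adjmx (ph z.2) *m O *m ph z.1) 0 0.

(* |psi> = int P(theta) e^{i gamma(theta)} |phi(theta)> dtheta,
   i.e. the (componentwise) integral of e^{i gamma} |phi> against the
   sampling probability measure P(theta) dtheta *)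
Definition psi (R : realType) (d : measure_display) (Theta : measurableType d)
  (P : probability Theta R) (gamma : Theta -> R) N (ph : Theta -> 'cV[R[i]]_N)
  : 'cV[R[i]]_N :=
  \col_(j < N)
    Complex (Rintegral P setT (fun th => complex.Re (expi (gamma th) * ph th j 0)))
            (Rintegral P setT (fun th => complex.Im (expi (gamma th) * ph th j 0))).

Definition expval (R : realType) N (ps : 'cV[R[i]]_N) (O : 'M[R[i]]_N) : R[i] :=
  (adjmx ps *m O *m ps) 0 0.

(* For each pair z = (theta, theta'), K z is the law of the measurement output
   hat X_z (a complex number encoded in R*R).  It is an unbiased estimator of
   X z with E|hat X_z - X z|^2 <= sigma^2. *)
Definition unbiased_with_var (R : realType) (d : measure_display)
  (T : measurableType d) (K : R.-pker T ~> (R * R)%type) (X : T -> R[i])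
  (sigma : R) : Prop :=
  forall z : T,
    (K z).-integrable setT (fun y => (y.1)%:E) /\
    (K z).-integrable setT (fun y => (y.2)%:E) /\
    (\int[K z]_y (y.1)%:E = (complex.Re (X z))%:E)%E /\
    (\int[K z]_y (y.2)%:E = (complex.Im (X z))%:E)%E /\
    (\int[K z]_y (csq (ctop y - X z))%:E <= (sigma ^+ 2)%:E)%E.

(* Law of one sample: draw (theta, theta') from P(theta)P(theta'), then
   measure: A |-> int K((theta,theta'), A) d(P x P)(theta,theta'). *)
Definition sample_law (R : realType) (d : measure_display)
  (Theta : measurableType d) (P : probability Theta R)
  (K : R.-pker (Theta * Theta)%type ~> (R * R)%type) (A : set (R * R)) : \bar R :=
  (\int[(P \x P)%E]_z K z A)%E.

Definition mutually_independent (R : realType) (d d' : measure_display)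
  (Omega : measurableType d) (T : measurableType d') (Pr : probability Omega R)
  (M : nat) (Z : 'I_M -> Omega -> T) : Prop :=
  forall A : 'I_M -> set T, (forall l, measurable (A l)) ->
    Pr (\bigcap_(l in [set: 'I_M]) (Z l @^-1` A l)) =
    (\prod_(l < M) Pr (Z l @^-1` A l))%E.

Definition estimator (R : realType) (Omega : Type) (M : nat)
  (Z : 'I_M -> Omega -> (R * R)%type) (w : Omega) : R[i] :=
  (\sum_(l < M) ctop (Z l w)) / M%:R.

(* Main.v *)
(** Each sample of the [O]-estimator has second moment at most
    [opnorm O ^+ 2 + sigmaO ^+ 2] (bias-variance split inside the kernel and
    Cauchy-Schwarz for [Xpair]), and by Fubini its mean is [expval ps O].
    Averaging [M] independent samples divides the mean square error by [M], so
    Chebyshev's inequality confines the estimator, outside an event of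
    probability [kappa], to the disc around its mean whose squared radius is
    the second-moment bound divided by [kappa * M%:R]; likewise for the
    identity, with bound [1 + sigma1 ^+ 2].  Off the two bad events one uses
    [a / b - A / B = ((a - A) - A / B * (b - B)) / b], where
    [cabs (A / B) <= opnorm O] and [cabs b >= cabs B - cabs (b - B)]; the
    hypothesis on [M] says precisely that the resulting bound is at most
    [eps].  *)
Require Import Defs.
From HB Require Import structures.
From mathcomp Require Import all_boot all_order all_algebra.
From mathcomp Require Import complex spectral.
From mathcomp Require Import all_classical all_reals all_analysis.
From mathcomp Require Import measurable_realfun ring lra.

Import Order.TTheory GRing.Theory Num.Theory.
Local Open Scope classical_set_scope.
Local Open Scope ring_scope.

(** * Complex modulus and operator norm *)

Section complex_abs.
Context {R : realType}.
Implicit Types z w : R[i].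

Lemma cabsE z : cabs z = Normc.normc z. Proof. by case: z. Qed.

Lemma csq_ge0 z : 0 <= csq z.
Proof. by rewrite addr_ge0 ?sqr_ge0. Qed.

Lemma sqr_cabs z : cabs z ^+ 2 = csq z.
Proof. by rewrite sqr_sqrtr ?csq_ge0. Qed.

Lemma cabs_ge0 z : 0 <= cabs z. Proof. exact: sqrtr_ge0. Qed.

Lemma cabs0 : cabs (0 : R[i]) = 0.
Proof. by rewrite cabsE Normc.normc0. Qed.

Lemma cabsM z w : cabs (z * w) = cabs z * cabs w.
Proof. by rewrite !cabsE Normc.normcM. Qed.

Lemma cabsV z : cabs z^-1 = (cabs z)^-1.
Proof. by rewrite !cabsE Normc.normcV. Qed.

Lemma cabsN z : cabs (- z) = cabs z.
Proof. by rewrite !cabsE normcN. Qed.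

Lemma cabsD z w : cabs (z + w) <= cabs z + cabs w.
Proof. by rewrite !cabsE le_normcD. Qed.

Lemma cabs_eq0 z : cabs z = 0 -> z = 0.
Proof. by rewrite cabsE => /Normc.eq0_normc. Qed.

Lemma cabs_conj z : cabs (Num.conj z) = cabs z.
Proof. by case: z => a b; rewrite /cabs /csq /= sqrrN. Qed.

Lemma cabs_expi (t : R) : cabs (expi t) = 1.
Proof. by rewrite /cabs /csq /= cos2Dsin2 sqrtr1. Qed.

Lemma cabs_sum (I : finType) (F : I -> R[i]) :
  cabs (\sum_i F i) <= \sum_i cabs (F i).
Proof.
elim/big_ind2: _ => [|x1 x2 y1 y2 h1 h2|//]; first by rewrite cabs0.
by apply: le_trans (cabsD _ _) _; exact: lerD.
Qed.

Lemma csqM z w : csq (z * w) = csq z * csq w.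
Proof. by rewrite -!sqr_cabs cabsM exprMn. Qed.

Lemma ler_cabs z (c : R) : 0 <= c -> (cabs z <= c) = (csq z <= c ^+ 2).
Proof. by move=> c0; rewrite -sqr_cabs ler_sqr ?nnegrE ?cabs_ge0. Qed.

(** After multiplication by [cabs b] it suffices that [dO + nO * d1 <= eps * cabs b], and
    [cabs b >= b0 - d1] reduces this to the last hypothesis. That hypothesis still allows [b = 0] in
    the extreme case [b0 = d1], so the convention [a / 0 = 0] is treated separately; there [0 < d1]
    is used. *)
Lemma cabs_quotient_sub_le (a b A B : R[i]) (dO d1 nO b0 eps : R) :
  0 < b0 -> cabs B = b0 -> cabs A <= nO * b0 ->
  0 < d1 -> 0 <= dO -> 0 <= nO -> 0 < eps ->
  cabs (a - A) <= dO -> cabs (b - B) <= d1 ->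
  dO + d1 * nO + eps * d1 <= eps * b0 ->
  cabs (a / b - A / B) <= eps.
Proof.
move=> b00 Bb A_le d10 dO0 nO0 eps0 aA bB bud.
have Bn0 : B != 0 by apply/eqP => B0; move: b00; rewrite -Bb B0 cabs0 ltxx.
have b0le : b0 <= cabs b + d1.
  rewrite -Bb (_ : B = b - (b - B)); last by rewrite opprB addrC subrK.
  by apply: le_trans (cabsD _ _) _; rewrite cabsN lerD2l.
have [bz|bn0] := eqVneq b 0.
  (* here [a / b = a / 0 = 0], and the budget forces [nO = 0], so [A = 0] *)
  have A0 : A = 0.
    apply: cabs_eq0; apply/eqP; rewrite eq_le cabs_ge0 andbT.
    apply: le_trans A_le _.
    have nO0' : nO <= 0.
      rewrite -(ler_pM2l d10) mulr0.
      have : eps * b0 <= eps * d1.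
        by rewrite ler_pM2l//; move: b0le; rewrite bz cabs0 add0r.
      lra.
    by rewrite mulr_le0_ge0 // ltW.
  by rewrite bz invr0 mulr0 A0 mul0r subr0 cabs0 ltW.
have -> : a / b - A / B = ((a - A) - A / B * (b - B)) / b.
  by field; rewrite bn0 Bn0.
have bp : 0 < cabs b.
  by rewrite lt_neqAle cabs_ge0 andbT eq_sym; apply: contraNneq bn0 => /cabs_eq0 ->.
rewrite cabsM cabsV ler_pdivrMr//.
apply: le_trans (cabsD _ _) _; rewrite cabsN !cabsM cabsV Bb.
have AB : cabs A / b0 <= nO by rewrite ler_pdivrMr.
have : cabs A / b0 * cabs (b - B) <= nO * d1.
  by apply: ler_pM => //; rewrite ?cabs_ge0// divr_ge0 ?cabs_ge0// ltW.
have : eps * b0 <= eps * (cabs b + d1) by rewrite ler_pM2l.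
lra.
Qed.

End complex_abs.

(** Expanding [0 <= \sum_i (Y * x i - D * y i) ^+ 2] gives [Y * (X * Y - D ^+ 2)], and a positive
    [Y] cancels. If [Y = 0], every [y i] vanishes. *)
Lemma real_cauchy_schwarz {R : realFieldType} (I : finType) (x y : I -> R) :
  (\sum_i x i * y i) ^+ 2 <= (\sum_i x i ^+ 2) * (\sum_i y i ^+ 2).
Proof.
set D := \sum_i x i * y i; set X := \sum_i x i ^+ 2; set Y := \sum_i y i ^+ 2.
have Y0 : 0 <= Y by apply: sumr_ge0 => i _; exact: sqr_ge0.
have [Yz|Yn0] := eqVneq Y 0.
  have y0 i : y i = 0.
    apply/eqP; rewrite -sqrf_eq0.
    by rewrite (psumr_eq0P _ Yz)// => j _; exact: sqr_ge0.
  by rewrite /D Yz mulr0 big1 ?expr0n// => i _; rewrite y0 mulr0.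
have Yp : 0 < Y by rewrite lt_neqAle eq_sym Yn0.
have : 0 <= \sum_i (Y * x i - D * y i) ^+ 2.
  by apply: sumr_ge0 => i _; exact: sqr_ge0.
have -> : \sum_i (Y * x i - D * y i) ^+ 2 = Y * (X * Y - D ^+ 2).
  transitivity (\sum_i (Y ^+ 2 * x i ^+ 2 - 2 * Y * D * (x i * y i) + D ^+ 2 * y i ^+ 2)).
    by apply: eq_bigr => i _; ring.
  rewrite big_split/= sumrB -!mulr_sumr -/X -/Y -/D; ring.
by rewrite pmulr_rge0// subr_ge0.
Qed.

(** * Vector norm, operator norm and unitary matrices *)

Section vectors.
Context {R : realType}.

Lemma vnorm_ge0 N (v : 'cV[R[i]]_N) : 0 <= vnorm v.
Proof. exact: sqrtr_ge0. Qed.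

Lemma sqr_vnorm N (v : 'cV[R[i]]_N) : vnorm v ^+ 2 = \sum_j csq (v j 0).
Proof. by rewrite sqr_sqrtr// sumr_ge0// => j _; exact: csq_ge0. Qed.

Lemma sum_cabsM_le N (u v : 'I_N -> R[i]) :
  (\sum_j cabs (u j) * cabs (v j)) ^+ 2 <=
  (\sum_j csq (u j)) * (\sum_j csq (v j)).
Proof.
apply: le_trans (real_cauchy_schwarz _ _ _) _.
by rewrite (eq_bigr _ (fun j _ => sqr_cabs (u j)))
           (eq_bigr _ (fun j _ => sqr_cabs (v j))).
Qed.

Lemma adjmx_mulE N (u v : 'cV[R[i]]_N) :
  (adjmx u *m v) 0 0 = \sum_j Num.conj (u j 0) * v j 0.
Proof. by rewrite mxE; apply: eq_bigr => j _; rewrite !mxE. Qed.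

Lemma cauchy_schwarz N (u v : 'cV[R[i]]_N) :
  cabs ((adjmx u *m v) 0 0) <= vnorm u * vnorm v.
Proof.
rewrite adjmx_mulE; apply: le_trans (cabs_sum _ _) _.
under eq_bigr do rewrite cabsM cabs_conj.
rewrite -ler_sqr ?nnegrE ?mulr_ge0 ?vnorm_ge0//; last first.
  by apply: sumr_ge0 => j _; rewrite mulr_ge0 ?cabs_ge0.
by rewrite exprMn !sqr_vnorm sum_cabsM_le.
Qed.

Lemma vnormZ N (c : R[i]) (v : 'cV[R[i]]_N) : vnorm (c *: v) = cabs c * vnorm v.
Proof.
apply/eqP; rewrite -(@eqrXn2 _ 2)// ?mulr_ge0 ?vnorm_ge0 ?cabs_ge0//.
rewrite exprMn !sqr_vnorm sqr_cabs mulr_sumr; apply/eqP.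
by apply: eq_bigr => j _; rewrite mxE csqM.
Qed.

Lemma vnorm_eq0 N (v : 'cV[R[i]]_N) : vnorm v = 0 -> v = 0.
Proof.
move=> v0; apply/matrixP => j k; rewrite (ord1 k) mxE.
apply: cabs_eq0; apply/eqP; rewrite -sqrf_eq0 sqr_cabs.
have s0 : \sum_j csq (v j 0) = 0 by rewrite -sqr_vnorm v0 expr0n.
by rewrite (psumr_eq0P _ s0)// => i _; exact: csq_ge0.
Qed.

(** The crude Frobenius bound, by Cauchy-Schwarz on each row. It serves to make the set defining
    [opnorm] bounded, so that its [sup] is a genuine supremum. *)
Lemma vnorm_mulmx_le N (O : 'M[R[i]]_N) (v : 'cV[R[i]]_N) :
  vnorm (O *m v) <= Num.sqrt (\sum_i \sum_j csq (O i j)) * vnorm v.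
Proof.
rewrite -ler_sqr ?nnegrE ?mulr_ge0 ?sqrtr_ge0 ?vnorm_ge0//.
rewrite exprMn !sqr_vnorm sqr_sqrtr; last first.
  by do 2 (apply: sumr_ge0 => ? _); exact: csq_ge0.
rewrite mulr_suml; apply: ler_sum => i _; rewrite mxE -sqr_cabs.
apply: le_trans (sum_cabsM_le _ (O i) (v^~ 0)).
rewrite ler_sqr ?nnegrE ?cabs_ge0//; last first.
  by apply: sumr_ge0 => j _; rewrite mulr_ge0 ?cabs_ge0.
by apply: le_trans (cabs_sum _ _) _; under eq_bigr do rewrite cabsM.
Qed.

Lemma opnorm_has_ub N (O : 'M[R[i]]_N) :
  has_ubound [set vnorm (O *m v) | v in [set v : 'cV[R[i]]_N | vnorm v = 1]].
Proof.
exists (Num.sqrt (\sum_i \sum_j csq (O i j))) => _ [w /= w1 <-].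
by apply: le_trans (vnorm_mulmx_le _ _ _) _; rewrite w1 mulr1.
Qed.

Lemma opnorm_ge0 N (O : 'M[R[i]]_N) : 0 <= opnorm O.
Proof.
rewrite /opnorm; have := opnorm_has_ub _ O; set S := [set _ | _ in _] => ubS.
(* In dimension 0 there is no unit vector; the supremum of the empty set is 0 by convention. *)
have [S0|/set0P[r Sr]] := eqVneq S set0; first by rewrite S0 sup0.
apply: le_trans (ub_le_sup ubS Sr).
by case: Sr => w _ <-; exact: vnorm_ge0.
Qed.

Lemma vnorm_opnorm_le N (O : 'M[R[i]]_N) (v : 'cV[R[i]]_N) :
  vnorm (O *m v) <= opnorm O * vnorm v.
Proof.
have [/eqP v0|v0] := boolP (vnorm v == 0).
  by rewrite (vnorm_eq0 _ _ v0) mulmx0 -[in leLHS](scale0r 0) vnormZ cabs0 mul0r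
             mulr_ge0 ?vnorm_ge0 ?opnorm_ge0.
have vp : 0 < vnorm v by rewrite lt_neqAle vnorm_ge0 eq_sym v0.
have cv : cabs (real_complex R (vnorm v)^-1) = (vnorm v)^-1.
  by rewrite /cabs /csq /= expr0n addr0 sqrtr_sqr ger0_norm ?invr_ge0 ?vnorm_ge0.
rewrite -ler_pdivrMr// mulrC -cv -vnormZ scalemxAr.
apply: (ub_le_sup (opnorm_has_ub _ O)).
by exists (real_complex R (vnorm v)^-1 *: v) => //=; rewrite vnormZ cv mulVf.
Qed.

Lemma cabs_sesqui_le N (O : 'M[R[i]]_N) (u v : 'cV[R[i]]_N) :
  cabs ((adjmx u *m O *m v) 0 0) <= opnorm O * (vnorm u * vnorm v).
Proof.
rewrite -mulmxA; apply: le_trans (cauchy_schwarz _ _ _) _.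
by rewrite mulrCA ler_wpM2l ?vnorm_ge0// vnorm_opnorm_le.
Qed.

Lemma adjmx_mul1 N (v : 'cV[R[i]]_N) :
  (adjmx v *m v) 0 0 = real_complex R (vnorm v ^+ 2).
Proof.
rewrite adjmx_mulE sqr_vnorm rmorph_sum; apply: eq_bigr => j _ /=.
case: (v j 0) => a b; apply/eqP; rewrite eq_complex /csq /=.
by apply/andP; split; apply/eqP; ring.
Qed.

Lemma expval1 N (v : 'cV[R[i]]_N) :
  expval v 1%:M = real_complex R (vnorm v ^+ 2).
Proof. by rewrite /expval mulmx1 adjmx_mul1. Qed.

Lemma vnorm_unitary n (U : 'M[R[i]]_n) (v : 'cV[R[i]]_n) :
  U \is unitarymx -> vnorm (U *m v) = vnorm v.
Proof.
move=> /unitarymxP UU; apply/eqP; rewrite -(@eqrXn2 _ 2)// ?vnorm_ge0//.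
apply/eqP/complexI; rewrite -!adjmx_mul1.
have -> : adjmx (U *m v) = adjmx v *m adjmx U.
  by rewrite /adjmx map_mxM trmx_mul.
rewrite mulmxA -(mulmxA (adjmx v)) (_ : adjmx U *m U = 1%:M) ?mulmx1//.
(* [unitarymx] provides [U] times its adjoint equal to 1; for a square matrix the product in the
   other order is then 1 as well. *)
by apply: mulmx1C; rewrite /adjmx map_trmx.
Qed.

Lemma vnorm_ket0 n : vnorm (ket0 R n) = 1.
Proof.
rewrite /vnorm (bigD1 (Ordinal (expn_gt0 2 n : (0 < 2 ^ n)%N)))//= big1.
  by rewrite mxE /= /csq /= expr1n expr0n !addr0 sqrtr1.
move=> j /negPf j0; rewrite mxE -[val j == 0%N]/(j == Ordinal (expn_gt0 2 n : (0 < 2 ^ n)%N)) j0.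
by rewrite /csq /= expr0n addr0.
Qed.

Lemma vnorm_phi n (T : Type) (U : T -> 'M[R[i]]_(2 ^ n)) th :
  U th \is unitarymx -> vnorm (phi U th) = 1.
Proof. by move=> hU; rewrite vnorm_unitary// vnorm_ket0. Qed.

End vectors.

(** * Integration, independence and kernels *)

Local Notation L1 mu f := (mu.-integrable setT (EFin \o f)).

Lemma measurable_le_fun {d} {T : measurableType d} {R : realType} (f g : T -> R) :
  measurable_fun setT f -> measurable_fun setT g -> measurable [set x | f x <= g x].
Proof.
by move=> mf mg; rewrite -[X in measurable X]setTI; exact: measurable_fun_le.
Qed.

Lemma measurable_gt_cst {d} {T : measurableType d} {R : realType} (f : T -> R) (c : R) :
  measurable_fun setT f -> measurable [set x | c < f x].
Proof.
move=> mf; have -> : [set x | c < f x] = ~` [set x | f x <= c].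
  apply/seteqP; split => x /=; first by rewrite ltNge => /negP.
  by move=> /negP; rewrite -ltNge.
by apply: measurableC; exact: measurable_le_fun.
Qed.

Section integrable_functions.
Context {d} {T : measurableType d} {R : realType} (mu : {measure set T -> \bar R}).
Implicit Types f g : T -> R.

Lemma L1_measurable f : L1 mu f -> measurable_fun setT f.
Proof. by move=> /measurable_int /measurable_EFinP. Qed.

Lemma L1D f g : L1 mu f -> L1 mu g -> L1 mu (fun x => f x + g x).
Proof. by move=> hf hg; apply: eq_integrable (integrableD _ hf hg). Qed.

Lemma L1B f g : L1 mu f -> L1 mu g -> L1 mu (fun x => f x - g x).
Proof. by move=> hf hg; apply: eq_integrable (integrableB _ hf hg). Qed.

Lemma L1Z (c : R) f : L1 mu f -> L1 mu (fun x => c * f x).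
Proof. by move=> hf; apply: eq_integrable (integrableZl _ c hf). Qed.

Lemma L1_sum (I : finType) (F : I -> T -> R) :
  (forall i, L1 mu (F i)) -> L1 mu (fun x => \sum_i F i x).
Proof.
move=> hF.
have := @integrable_sum _ _ _ mu _ measurableT _ (index_enum I) xpredT
  (fun i => EFin \o F i) (fun i _ => hF i).
by apply: eq_integrable => // x _; rewrite /= sumEFin.
Qed.

Lemma Rintegral_sum (I : finType) (F : I -> T -> R) :
  (forall i, L1 mu (F i)) ->
  \int[mu]_x (\sum_i F i x) = \sum_i \int[mu]_x F i x.
Proof.
move=> hF; rewrite /Rintegral.
under eq_integral do rewrite -sumEFin.
rewrite integral_sum// -sum_fine// => i _.
exact: integrable_fin_num (hF i).
Qed.

Lemma ge0_L1 f (V : R) : measurable_fun setT f -> (forall x, 0 <= f x) ->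
  (\int[mu]_x (f x)%:E <= V%:E)%E -> L1 mu f.
Proof.
move=> mf f0 fV; apply/integrableP; split; first exact/measurable_EFinP.
under eq_integral do rewrite /= ger0_norm//.
exact: le_lt_trans fV (ltry _).
Qed.

Lemma L1_le f g : measurable_fun setT f -> (forall x, `|f x| <= g x) ->
  L1 mu g -> L1 mu f.
Proof.
move=> mf fg; apply: le_integrable => //; first exact/measurable_EFinP.
by move=> x _; rewrite /= lee_fin (le_trans (fg x))// ler_norm.
Qed.

(** The product is dominated by [f ^+ 2 + g ^+ 2], a consequence of the nonnegative square of the
    difference of the absolute values. *)
Lemma L1_mul_sqr f g : measurable_fun setT f -> measurable_fun setT g ->
  L1 mu (fun x => f x ^+ 2) -> L1 mu (fun x => g x ^+ 2) ->
  L1 mu (fun x => f x * g x).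
Proof.
move=> mf mg f2 g2; apply: L1_le (L1D _ _ f2 g2); first exact: measurable_funM.
move=> x; rewrite normrM -(real_normK (num_real (f x))) -(real_normK (num_real (g x))).
have := sqr_ge0 (`|f x| - `|g x|); have := normr_ge0 (f x).
have := normr_ge0 (g x); nra.
Qed.

(** Bienaymé's identity: the square expands into a double sum of which only the diagonal survives.
    This is the source of the factor [1 / M] in the mean square error. *)
Lemma Rintegral_sqr_sum M (Y : 'I_M -> T -> R) :
  (forall l, measurable_fun setT (Y l)) ->
  (forall l, L1 mu (fun x => Y l x ^+ 2)) ->
  (forall l k, l != k -> \int[mu]_x (Y l x * Y k x) = 0) ->
  \int[mu]_x (\sum_l Y l x) ^+ 2 = \sum_l \int[mu]_x (Y l x ^+ 2).
Proof.
move=> mY Y2 Y0.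
have iY l k : L1 mu (fun x => Y l x * Y k x) by exact: L1_mul_sqr.
transitivity (\int[mu]_x \sum_l \sum_k (Y l x * Y k x)).
  apply: eq_Rintegral => x _; rewrite expr2 mulr_suml.
  by apply: eq_bigr => l _; rewrite mulr_sumr.
rewrite (Rintegral_sum _ (fun l x => \sum_k Y l x * Y k x)); last first.
  by move=> l; exact: L1_sum.
apply: eq_bigr => l _; rewrite (Rintegral_sum _ (fun k x => Y l x * Y k x))//.
rewrite (bigD1 l)//= big1 ?addr0// => k kl.
by rewrite Y0// eq_sym.
Qed.

Lemma L1_sqr_sum M (Y : 'I_M -> T -> R) :
  (forall l, measurable_fun setT (Y l)) ->
  (forall l, L1 mu (fun x => Y l x ^+ 2)) ->
  L1 mu (fun x => (\sum_l Y l x) ^+ 2).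
Proof.
move=> mY Y2.
have := L1_sum _ _ (fun l => L1_sum _ _ (fun k => L1_mul_sqr _ _ (mY l) (mY k) (Y2 l) (Y2 k))).
apply: eq_integrable => // x _ /=; congr EFin.
by rewrite expr2 mulr_suml; apply: eq_bigr => l _; rewrite mulr_sumr.
Qed.

End integrable_functions.

(** * Second moments and Markov's inequality on a probability space *)

Section square_integrable.
Context {d} {T : measurableType d} {R : realType} (P : probability T R).
Implicit Types f g : T -> R.

Lemma L1_cst (c : R) : L1 P (cst c).
Proof. exact: finite_measure_integrable_cst. Qed.

Lemma L1_bounded f (C : R) : measurable_fun setT f ->
  (forall x, `|f x| <= C) -> L1 P f.
Proof. by move=> mf fC; apply: L1_le _ _ _ mf fC (L1_cst C). Qed.

(** Domination by [f ^+ 2 + 1], where the constant is integrable because the total mass is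
    finite. *)
Lemma L1_of_sqr f : measurable_fun setT f -> L1 P (fun x => f x ^+ 2) -> L1 P f.
Proof.
move=> mf f2; apply: (L1_le P _ (fun x => f x ^+ 2 + 1)) => //; last exact: L1D f2 (L1_cst 1).
move=> x; rewrite -(real_normK (num_real (f x))).
have := sqr_ge0 (`|f x| - 1); have := normr_ge0 (f x); nra.
Qed.

Lemma L1_sqrB f (m : R) : measurable_fun setT f -> L1 P (fun x => f x ^+ 2) ->
  L1 P (fun x => (f x - m) ^+ 2).
Proof.
move=> mf f2.
have := L1D P _ _ (L1B P _ _ f2 (L1Z P (2 * m) _ (L1_of_sqr _ mf f2))) (L1_cst (m ^+ 2)).
by apply: eq_integrable => // x _ /=; congr EFin; ring.
Qed.

Lemma Rintegral_sqr_centered f (m : R) : measurable_fun setT f ->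
  L1 P (fun x => f x ^+ 2) -> \int[P]_x f x = m ->
  \int[P]_x (f x - m) ^+ 2 = \int[P]_x (f x ^+ 2) - m ^+ 2.
Proof.
move=> mf f2 fm; have f1 := L1_of_sqr _ mf f2.
transitivity (\int[P]_x (f x ^+ 2 - 2 * m * f x + m ^+ 2)).
  by apply: eq_Rintegral => x _; ring.
rewrite RintegralD//; [|exact: L1B P _ _ f2 (L1Z P _ _ f1)|exact: L1_cst].
rewrite RintegralB//; last exact: L1Z f1.
rewrite RintegralZl// fm Rintegral_cst//= probability_setT mulr1; ring.
Qed.

(** The strict inequality in the event lets [c = 0] be included: then [f] has integral 0, so it
    vanishes almost everywhere and the event is null. This case arises for a noiseless estimator of
    an operator of norm 0. For [c > 0] it is Markov's inequality on the larger event [c <= f]. *)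
Lemma markov_gt f (c k : R) : measurable_fun setT f -> (forall x, 0 <= f x) ->
  0 <= c -> 0 < k -> (\int[P]_x (f x)%:E <= (c * k)%:E)%E ->
  (P [set x | c < f x]%R <= k%:E)%E.
Proof.
move=> mf f0 c0 k0 fck.
have mfE : measurable_fun setT (EFin \o f) by exact/measurable_EFinP.
have mlt := measurable_gt_cst f c mf.
have [cz|cn0] := eqVneq c 0.
  have /(ae_eq_integral_abs P measurableT mfE) : (\int[P]_x `|(EFin \o f) x| = 0)%E.
    under eq_integral do rewrite /= ger0_norm//.
    apply/eqP; rewrite eq_le; apply/andP; split.
      by apply: le_trans fck _; rewrite cz mul0r.
    by apply: integral_ge0 => x _; rewrite lee_fin.
  case=> N [mN N0 fN]; apply: (@le_trans _ _ (P N)); last by rewrite N0 lee_fin ltW.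
  apply: le_measure; rewrite ?inE//.
  move=> x /= cf; apply: fN => /= /(_ I) [] fx0.
  by move: cf; rewrite fx0 cz ltxx.
have cp : 0 < c by rewrite lt_neqAle eq_sym cn0.
have : (c%:E * P (setT `&` [set x | (c%:E <= `|(EFin \o f) x|)%E]) <= (c * k)%:E)%E.
  apply: le_trans (@le_integral_comp_abse _ _ _ P _ measurableT _ c id _ _ _ mfE cp) _ => //.
  by under eq_integral do rewrite /= ger0_norm//.
rewrite EFinM lee_pmul2l ?fin_numE//; apply: le_trans.
apply: le_measure; rewrite ?inE//.
- by apply: emeasurable_fun_c_infty => //; exact: measurableT_comp.
- by move=> x /= cf; split=> //; rewrite lee_fin ger0_norm// ltW.
Qed.

End square_integrable.

(** * Fubini for products of functions of separate variables *)

Section product.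
Context {d1 d2} {T1 : measurableType d1} {T2 : measurableType d2} {R : realType}.
Context (P1 : probability T1 R) (P2 : probability T2 R) (f : T1 -> R) (g : T2 -> R).
Hypotheses (L1f : L1 P1 f) (L1g : L1 P2 g).

(** By Tonelli, the iterated integral of the absolute value is the product of the two finite
    integrals of [normr \o f] and [normr \o g]. *)
Lemma L1_prod : L1 (P1 \x P2)%E (fun z => f z.1 * g z.2).
Proof.
have mfg : measurable_fun setT (EFin \o (fun z : T1 * T2 => f z.1 * g z.2)).
  apply/measurable_EFinP/measurable_funM.
    exact: measurableT_comp (L1_measurable _ _ L1f) _.
  exact: measurableT_comp (L1_measurable _ _ L1g) _.
apply: (proj2 (integrable12ltyP P1 P2 mfg)).
under eq_integral => x _.
  under eq_integral => y _ do rewrite /= normrM EFinM.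
  rewrite ge0_integralZl//; last first.
    apply/measurable_EFinP/measurableT_comp => //; exact: L1_measurable L1g.
  over.
rewrite ge0_integralZr//; last 2 first.
  by apply/measurable_EFinP/measurableT_comp => //; exact: L1_measurable L1f.
  by apply: integral_ge0 => y _; rewrite lee_fin.
by apply: lte_mul_pinfty; first exact: integral_ge0;
  [rewrite ge0_fin_numE ?integral_ge0//; case/integrableP: L1f|case/integrableP: L1g].
Qed.

Lemma Rintegral_prod :
  \int[(P1 \x P2)%E]_z (f z.1 * g z.2) = \int[P1]_x f x * \int[P2]_y g y.
Proof.
rewrite [LHS]/Rintegral -integral12_prod_meas1; last exact: L1_prod.
rewrite -RintegralZr// /Rintegral; congr fine; apply: eq_integral => x _.
rewrite /fubini_F /= (eq_integral (fun y => (f x)%:E * (g y)%:E)%E)//.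
by rewrite integralZl// EFinM fineK// integrable_fin_num.
Qed.

End product.

(** * Independence and factorisation of expectations *)

Section independence.
Context {d d'} {Omega : measurableType d} {T : measurableType d'} {R : realType}.
Context (Pr : probability Omega R).

(** Take the full space at every other index: those preimages have probability 1 and drop out of the
    product. *)
Lemma mutually_independent_pair M (Z : 'I_M -> Omega -> T) (l k : 'I_M) A B :
  mutually_independent Pr Z -> l != k -> measurable A -> measurable B ->
  Pr (Z l @^-1` A `&` Z k @^-1` B) = (Pr (Z l @^-1` A) * Pr (Z k @^-1` B))%E.
Proof.
move=> indep lk mA mB.
pose C i := if i == l then A else if i == k then B else setT.
have mC i : measurable (C i) by rewrite /C; case: ifP => //; case: ifP.
have := indep C mC.
have -> : \bigcap_(i in [set: 'I_M]) (Z i @^-1` C i) = Z l @^-1` A `&` Z k @^-1` B.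
  apply/seteqP; split => w /=.
    move=> h; split; first by have := h l I; rewrite /C eqxx.
    by have := h k I; rewrite /C eq_sym (negPf lk) eqxx.
  move=> [hA hB] i _; rewrite /C; case: eqP => [->//|_].
  by case: eqP => [->//|_].
move=> ->; rewrite (bigD1 l)//= (bigD1 k)/=; last by rewrite eq_sym.
rewrite /C eqxx [k == l]eq_sym (negPf lk) eqxx big1 ?mule1// => i /andP[il ik].
by rewrite (negPf il) (negPf ik) preimage_setT probability_setT.
Qed.

(** The joint law of [(X, Y)] is the product of the marginal laws, so the expectation becomes an
    integral over a product measure, where Fubini applies. *)
Lemma Rintegral_indep_mul (X Y : {RV Pr >-> T}) (f g : T -> R) :
  (forall A B, measurable A -> measurable B ->
     Pr (X @^-1` A `&` Y @^-1` B) = (Pr (X @^-1` A) * Pr (Y @^-1` B))%E) ->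
  measurable_fun setT f -> measurable_fun setT g ->
  L1 Pr (f \o X) -> L1 Pr (g \o Y) ->
  \int[Pr]_w (f (X w) * g (Y w)) = \int[Pr]_w f (X w) * \int[Pr]_w g (Y w).
Proof.
move=> indep mf mg iX iY.
have mXY : measurable_fun setT (fun w => (X w, Y w)).
  exact: measurable_fun_pair.
pose XY : {RV Pr >-> (T * T)%type} :=
  HB.pack (fun w => (X w, Y w)) (isMeasurableFun.Build _ _ _ _ _ mXY).
pose QX := distribution Pr X; pose QY := distribution Pr Y.
(* The two measures agree on rectangles by [indep], and rectangles determine the product measure. *)
have QE A : measurable A -> (QX \x QY)%E A = distribution Pr XY A.
  by move=> mA; apply: product_measure_unique => // B C mB mC; rewrite /= -indep.
have QXf : L1 QX f by apply: integrable_pushforward => //; exact/measurable_EFinP.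
have QYg : L1 QY g by apply: integrable_pushforward => //; exact/measurable_EFinP.
pose h (z : T * T) := f z.1 * g z.2.
have mh : measurable_fun setT h.
  by apply: measurable_funM; [exact: measurableT_comp mf _|exact: measurableT_comp mg _].
have QXYh : L1 (distribution Pr XY) h.
  have /integrableP[_ hfin] := L1_prod QX QY f g QXf QYg.
  apply/integrableP; split; first exact/measurable_EFinP.
  by rewrite (eq_measure_integral (QX \x QY)%E) => [//|A mA _]; rewrite /= -QE.
have iXY : L1 Pr (h \o XY).
  apply/integrableP; split; first exact/measurable_EFinP/measurableT_comp.
  move/integrableP : QXYh => [_]; rewrite ge0_integral_distribution//.
  by apply: measurableT_comp => //; exact/measurable_EFinP.
have dE (V : {RV Pr >-> T}) (k : T -> R) : measurable_fun setT k ->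
    L1 Pr (k \o V) -> \int[Pr]_w k (V w) = \int[distribution Pr V]_y k y.
  by move=> mk ik; rewrite /Rintegral integral_distribution//; exact/measurable_EFinP.
rewrite (dE X f)// (dE Y g)// -Rintegral_prod//.
rewrite /Rintegral; congr fine.
transitivity (\int[distribution Pr XY]_z (h z)%:E)%E.
  by rewrite integral_distribution//; exact/measurable_EFinP.
by apply/esym/eq_measure_integral => A mA _; exact: QE.
Qed.

End independence.

(** * Integration against the law of a two-stage draw *)

Section law.
Context {d1 d2 d} {T1 : measurableType d1} {T : measurableType d2}
  {Omega : measurableType d} {R : realType}.
Context (P : probability T1 R) (K : R.-pker T1 ~> T) (Pr : probability Omega R)
  (Z : Omega -> T).
Hypothesis mZ : measurable_fun setT Z.
Hypothesis ZK : forall A, measurable A -> Pr (Z @^-1` A) = (\int[P]_x K x A)%E.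
Local Open Scope ereal_scope.

(** [ZK] makes the law of [Z] the mixture of the measures [K x] over [P]; kernel composition extends
    this from sets to nonnegative functions. Values in the extended reals let the identity serve to
    prove finiteness too. *)
Lemma ge0_integral_law (f : T -> \bar R) :
  (forall y, 0 <= f y) -> measurable_fun setT f ->
  \int[Pr]_w f (Z w) = \int[P]_x \int[K x]_y f y.
Proof.
move=> f0 mf.
(* [integral_kcomp] composes kernels, so [P] becomes a kernel out of [unit] and
   [K] ignores that extra argument. *)
pose kP := kprobability (measurable_cst (P : pprobability T1 R) : measurable_fun [set: unit] _).
have := @integral_kcomp _ _ _ _ _ _ R kP (kernel.kernel_snd K) tt f f0 mf.
move=> /= <-.
rewrite -(@ge0_integral_pushforward _ _ _ _ _ Z mZ Pr setT f)//.
apply: eq_measure_integral => A mA _.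
exact: ZK.
Qed.

Lemma measurable_integral_ker (f : T -> \bar R) :
  (forall y, 0 <= f y) -> measurable_fun setT f ->
  measurable_fun setT (fun x => \int[K x]_y f y).
Proof. by move=> f0 mf; apply: measurable_fun_integral_kernel => // U mU; exact: measurable_kernel. Qed.

(** Apply the nonnegative case to the positive and negative parts of [f], then recombine. *)
Lemma integral_law (f : T -> R) (g : T1 -> R) :
  L1 Pr (f \o Z) -> measurable_fun setT f ->
  (forall x, L1 (K x) f) -> (forall x, \int[K x]_y (f y)%:E = (g x)%:E) ->
  \int[Pr]_w (f (Z w))%:E = \int[P]_x (g x)%:E.
Proof.
move=> iZ mf iK Kg; pose F := EFin \o f.
have mF : measurable_fun setT F by exact/measurable_EFinP.
(* Integrability of each part under [Pr] passes to its inner integral under [P]; this is what allows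
   the two outer integrals to be subtracted. *)
have pos (h : T -> \bar R) (h0 : forall y, 0 <= h y) (mh : measurable_fun setT h) :
    Pr.-integrable setT (h \o Z) -> P.-integrable setT (fun x => \int[K x]_y h y).
  move=> ih; apply/integrableP; split; first exact: measurable_integral_ker.
  under eq_integral => x _ do rewrite gee0_abs ?integral_ge0//.
  by rewrite -ge0_integral_law//; exact: integrable_lty.
have mFp := measurable_funepos mF; have mFn := measurable_funeneg mF.
transitivity (\int[Pr]_w (F \o Z) w); first by [].
rewrite integralE.
under [X in X - _]eq_integral do rewrite funepos_comp/=.
under [X in _ - X]eq_integral do rewrite funeneg_comp/=.
rewrite !ge0_integral_law//.
rewrite -integralB//.
- by apply: eq_integral => x _; rewrite -Kg [RHS]integralE.
- apply: pos => //.
  have := integrable_funepos measurableT iZ; apply: eq_integrable => // w _.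
  by rewrite -funepos_comp.
- apply: pos => //.
  have := integrable_funeneg measurableT iZ; apply: eq_integrable => // w _.
  by rewrite -funeneg_comp.
Qed.

End law.

(** * Complex integrals and the expectation of the pair value *)

Section complex_integral.
Context {R : realType}.
Notation Re := (@complex.Re R).
Notation Im := (@complex.Im R).

Definition cL1 {d} {T : measurableType d} (P : probability T R) (f : T -> R[i]) :=
  L1 P (fun x => Re (f x)) /\ L1 P (fun x => Im (f x)).

(** The same pair of real integrals as in the entries of [psi], so that those entries are values of
    [cint] by unfolding. *)
Definition cint {d} {T : measurableType d} (P : probability T R) (f : T -> R[i]) : R[i] :=
  Complex (\int[P]_x Re (f x)) (\int[P]_x Im (f x)).

Lemma Re_mul (z w : R[i]) : Re (z * w) = Re z * Re w - Im z * Im w.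
Proof. by case: z; case: w. Qed.

Lemma Im_mul (z w : R[i]) : Im (z * w) = Re z * Im w + Im z * Re w.
Proof. by case: z; case: w. Qed.

Lemma Re_sum (I : finType) (F : I -> R[i]) : Re (\sum_i F i) = \sum_i Re (F i).
Proof. by apply: big_morph => // -[? ?] [? ?]. Qed.

Lemma Im_sum (I : finType) (F : I -> R[i]) : Im (\sum_i F i) = \sum_i Im (F i).
Proof. by apply: big_morph => // -[? ?] [? ?]. Qed.

Section single.
Context {d} {T : measurableType d} (P : probability T R).

Lemma cL1_sum (I : finType) (F : I -> T -> R[i]) :
  (forall i, cL1 P (F i)) -> cL1 P (fun x => \sum_i F i x).
Proof.
move=> hF; split.
- have := L1_sum P _ _ (fun i => (hF i).1).
  by apply: eq_integrable => // x _ /=; rewrite Re_sum.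
- have := L1_sum P _ _ (fun i => (hF i).2).
  by apply: eq_integrable => // x _ /=; rewrite Im_sum.
Qed.

Lemma cint_sum (I : finType) (F : I -> T -> R[i]) :
  (forall i, cL1 P (F i)) -> cint P (fun x => \sum_i F i x) = \sum_i cint P (F i).
Proof.
move=> hF; apply/eqP; rewrite eq_complex Re_sum Im_sum /=.
rewrite -(Rintegral_sum P _ (fun i x => Re (F i x)))//; last by move=> i; exact: (hF i).1.
rewrite -(Rintegral_sum P _ (fun i x => Im (F i x)))//; last by move=> i; exact: (hF i).2.
by apply/andP; split; apply/eqP; apply: eq_Rintegral => x _; rewrite ?Re_sum ?Im_sum.
Qed.

Lemma cL1Z (c : R[i]) (f : T -> R[i]) : cL1 P f -> cL1 P (fun x => c * f x).
Proof.
case=> f1 f2; split.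
- have := L1B P _ _ (L1Z P (Re c) _ f1) (L1Z P (Im c) _ f2).
  by apply: eq_integrable => // x _ /=; rewrite Re_mul.
- have := L1D P _ _ (L1Z P (Re c) _ f2) (L1Z P (Im c) _ f1).
  by apply: eq_integrable => // x _ /=; rewrite Im_mul.
Qed.

Lemma cintZ (c : R[i]) (f : T -> R[i]) : cL1 P f ->
  cint P (fun x => c * f x) = c * cint P f.
Proof.
case=> f1 f2; apply/eqP; rewrite eq_complex Re_mul Im_mul /=.
rewrite -!RintegralZl// -RintegralB//; [|exact: L1Z f1|exact: L1Z f2].
rewrite -RintegralD//; [|exact: L1Z f2|exact: L1Z f1].
by apply/andP; split; apply/eqP; apply: eq_Rintegral => x _; rewrite ?Re_mul ?Im_mul.
Qed.

Lemma cL1_conj (f : T -> R[i]) : cL1 P f -> cL1 P (fun x => Num.conj (f x)).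
Proof.
case=> f1 f2; split.
- by move: f1; apply: eq_integrable => // x _ /=; case: (f x).
- have := L1Z P (-1) _ f2.
  by apply: eq_integrable => // x _ /=; rewrite mulN1r; case: (f x).
Qed.

Lemma cint_conj (f : T -> R[i]) : cL1 P f ->
  cint P (fun x => Num.conj (f x)) = Num.conj (cint P f).
Proof.
case=> f1 f2; apply/eqP; rewrite eq_complex /=; apply/andP; split; apply/eqP.
  by apply: eq_Rintegral => x _; case: (f x).
rewrite -mulN1r -RintegralZl//.
by apply: eq_Rintegral => x _; rewrite mulN1r; case: (f x).
Qed.

Lemma cL1_bounded (f : T -> R[i]) (C : R) :
  measurable_fun setT (fun x => Re (f x)) ->
  measurable_fun setT (fun x => Im (f x)) ->
  (forall x, cabs (f x) <= C) -> cL1 P f.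
Proof.
move=> mr mi fC; split; apply: (L1_bounded _ _ C) => // x; apply: le_trans (fC x).
- rewrite -sqrtr_sqr /cabs /csq ler_sqrt ?lerDl ?sqr_ge0// addr_ge0 ?sqr_ge0//.
- rewrite -sqrtr_sqr /cabs /csq ler_sqrt ?lerDr ?sqr_ge0// addr_ge0 ?sqr_ge0//.
Qed.

End single.

Section prod.
Context {d1 d2} {T1 : measurableType d1} {T2 : measurableType d2}.
Context (P1 : probability T1 R) (P2 : probability T2 R).
Context (f : T1 -> R[i]) (g : T2 -> R[i]).
Hypotheses (hf : cL1 P1 f) (hg : cL1 P2 g).

Lemma cL1_prod : cL1 (P1 \x P2)%E (fun z => f z.1 * g z.2).
Proof.
case: hf hg => f1 f2 [g1 g2]; split.
- have := L1B _ _ _ (L1_prod P1 P2 _ _ f1 g1) (L1_prod P1 P2 _ _ f2 g2).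
  by apply: eq_integrable => // x _ /=; rewrite Re_mul.
- have := L1D _ _ _ (L1_prod P1 P2 _ _ f1 g2) (L1_prod P1 P2 _ _ f2 g1).
  by apply: eq_integrable => // x _ /=; rewrite Im_mul.
Qed.

Lemma cint_prod :
  cint (P1 \x P2)%E (fun z => f z.1 * g z.2) = cint P1 f * cint P2 g.
Proof.
case: hf hg => f1 f2 [g1 g2]; apply/eqP; rewrite eq_complex Re_mul Im_mul /=.
rewrite -!Rintegral_prod// -RintegralB//; [|exact: L1_prod f1 g1|exact: L1_prod f2 g2].
rewrite -RintegralD//; [|exact: L1_prod f1 g2|exact: L1_prod f2 g1].
by apply/andP; split; apply/eqP; apply: eq_Rintegral => x _; rewrite ?Re_mul ?Im_mul.
Qed.

End prod.

End complex_integral.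

(** * Mean and modulus of the pair value *)

Section expectation.
Context {R : realType} {d} {Theta : measurableType d} (P : probability Theta R).
Context (gamma : Theta -> R) {N : nat} (ph : Theta -> 'cV[R[i]]_N) (O : 'M[R[i]]_N).
Hypothesis mgamma : measurable_fun setT gamma.
Hypothesis mphRe : forall j, measurable_fun setT (fun th => complex.Re (ph th j 0)).
Hypothesis mphIm : forall j, measurable_fun setT (fun th => complex.Im (ph th j 0)).
Hypothesis ph1 : forall th, vnorm (ph th) = 1.

(** The integrand of entry [j] of [psi]. *)
Let u j th := expi (gamma th) * ph th j 0.

(** An entry of a unit vector has modulus at most 1 and the phase has modulus 1, so the integrand is
    bounded. *)
Lemma cL1_phased j : cL1 P (u j).
Proof.
have mc : measurable_fun setT (fun th => cos (gamma th)).
  by apply: measurableT_comp => //; apply: continuous_measurable_fun; exact: continuous_cos.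
have ms : measurable_fun setT (fun th => sin (gamma th)).
  by apply: measurableT_comp => //; apply: continuous_measurable_fun; exact: continuous_sin.
apply: (cL1_bounded _ _ 1).
- under eq_fun do rewrite Re_mul /=.
  by apply: measurable_funB; exact: measurable_funM.
- under eq_fun do rewrite Im_mul /=.
  by apply: measurable_funD; exact: measurable_funM.
- move=> th; rewrite cabsM cabs_expi mul1r ler_cabs// expr1n.
  have <- : vnorm (ph th) ^+ 2 = 1 by rewrite ph1 expr1n.
  rewrite sqr_vnorm (bigD1 j)//= lerDl.
  by apply: sumr_ge0 => k _; exact: csq_ge0.
Qed.

(** Separates the variables: the phase of the difference splits into a factor in [z.1] and a
    conjugate factor in [z.2], so each term is a product to which Fubini applies. *)
Lemma XpairE z :
  Xpair gamma ph O z = \sum_k \sum_j O j k * (u k z.1 * Num.conj (u j z.2)).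
Proof.
rewrite /Xpair mxE mulr_sumr; apply: eq_bigr => k _.
rewrite mxE mulr_suml mulr_sumr; apply: eq_bigr => j _.
rewrite !mxE /u rmorphM.
have -> : expi (gamma z.1 - gamma z.2) =
    expi (gamma z.1) * Num.conj (expi (gamma z.2)).
  by apply/eqP; rewrite eq_complex /= cosB sinB; apply/andP; split; apply/eqP; ring.
by ring.
Qed.

(** Integrating the separated double sum termwise turns each factor into an entry of [psi] or its
    conjugate, which reassembles the sesquilinear form. *)
Lemma cint_Xpair : cint (P \x P)%E (Xpair gamma ph O) = expval (psi P gamma ph) O.
Proof.
rewrite (_ : Xpair _ _ _ =
  (fun z => \sum_k \sum_j O j k * (u k z.1 * Num.conj (u j z.2)))); last first.
  by apply/funext => z; exact: XpairE.
have ukj k j : cL1 (P \x P)%E (fun z => u k z.1 * Num.conj (u j z.2)).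
  apply: (cL1_prod P P (u k) (fun t => Num.conj (u j t))); first exact: cL1_phased.
  exact/cL1_conj/cL1_phased.
rewrite cint_sum; last by move=> k; apply: cL1_sum => j; exact: cL1Z.
rewrite /expval mxE; apply: eq_bigr => k _.
rewrite cint_sum; last by move=> j; exact: cL1Z.
rewrite mxE mulr_suml; apply: eq_bigr => j _.
rewrite cintZ// (cint_prod P P (u k) (fun t => Num.conj (u j t))); last first.
  exact/cL1_conj/cL1_phased.
  exact: cL1_phased.
rewrite cint_conj; last exact: cL1_phased.
have psiE i : psi P gamma ph i 0 = cint P (u i) by rewrite mxE.
have -> : adjmx (psi P gamma ph) 0 j = Num.conj (psi P gamma ph j 0) by rewrite 2!mxE.
by rewrite !psiE; ring.
Qed.

Lemma cabs_Xpair_le (z : Theta * Theta) : cabs (Xpair gamma ph O z) <= opnorm O.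
Proof.
rewrite /Xpair cabsM cabs_expi mul1r; apply: le_trans (cabs_sesqui_le _ _ _ _) _.
by rewrite !ph1 !mulr1.
Qed.

(** Cauchy-Schwarz directly, with constant 1; this is the 1 in [1 + sigma1 ^+ 2]. *)
Lemma cabs_Xpair1_le (z : Theta * Theta) : cabs (Xpair gamma ph 1%:M z) <= 1.
Proof.
rewrite /Xpair cabsM cabs_expi mul1r mulmx1; apply: le_trans (cauchy_schwarz _ _ _) _.
by rewrite !ph1 mulr1.
Qed.

End expectation.

(** * Deviation of the estimators *)

Lemma measurable_csq {R : realType} {d} {T : measurableType d} (f g : T -> R) :
  measurable_fun setT f -> measurable_fun setT g ->
  measurable_fun setT (fun x => csq (Complex (f x) (g x))).
Proof.
by move=> mf mg; apply: measurable_funD; exact: measurable_funX.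
Qed.

Lemma csq_sub {R : realType} (z w : R[i]) :
  csq (z - w) = (complex.Re z - complex.Re w) ^+ 2 + (complex.Im z - complex.Im w) ^+ 2.
Proof. by case: z; case: w. Qed.

(** Split on [b x = 0]. There the quotient is 0 and the condition is [cabs c <= eps], independent of
    [x]. Elsewhere, multiplying by [cabs (b x)] and squaring gives a polynomial inequality between
    measurable real functions. *)
Lemma measurable_quotient_sub_le {R : realType} {d} {T : measurableType d}
    (a b : T -> R[i]) (c : R[i]) (eps : R) : 0 <= eps ->
  measurable_fun setT (fun x => complex.Re (a x)) ->
  measurable_fun setT (fun x => complex.Im (a x)) ->
  measurable_fun setT (fun x => complex.Re (b x)) ->
  measurable_fun setT (fun x => complex.Im (b x)) ->
  measurable [set x | cabs (a x / b x - c) <= eps].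
Proof.
move=> eps0 ma1 ma2 mb1 mb2.
have mb : measurable_fun setT (fun x => csq (b x)).
  by apply: measurable_funD; exact: measurable_funX.
pose S0 := [set x | csq (b x) <= 0].
pose S1 := [set x | csq (a x - c * b x) <= eps ^+ 2 * csq (b x)].
have mS0 : measurable S0 by exact: measurable_le_fun.
have mS1 : measurable S1.
  apply: measurable_le_fun; last exact: measurable_funM.
  under eq_fun do rewrite csq_sub Re_mul Im_mul.
  apply: measurable_funD; apply: measurable_funX; apply: measurable_funB => //.
    by apply: measurable_funB; exact: measurable_funM.
  by apply: measurable_funD; exact: measurable_funM.
have b0 x : S0 x <-> b x = 0.
  rewrite /S0 /=; split=> [bx|->]; last by rewrite /csq /= expr0n addr0.
  apply: cabs_eq0; apply/eqP; rewrite -sqrf_eq0 sqr_cabs.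
  by rewrite eq_le bx csq_ge0.
rewrite (_ : [set x | _] =
  (S0 `&` [set _ | cabs c <= eps]) `|` (~` S0 `&` S1)); last first.
  have S1E x : b x != 0 -> (cabs (a x / b x - c) <= eps) = (csq (a x - c * b x) <= eps ^+ 2 * csq (b x)).
    move=> bx; have -> : a x / b x - c = (a x - c * b x) / b x by field.
    have bp : 0 < cabs (b x).
      by rewrite lt_neqAle cabs_ge0 andbT eq_sym; apply: contraNneq bx => /cabs_eq0 ->.
    rewrite cabsM cabsV ler_pdivrMr// ler_cabs ?mulr_ge0 ?cabs_ge0//.
    by rewrite exprMn sqr_cabs.
  apply/seteqP; split => x /=.
    have [bx|bx] := eqVneq (b x) 0.
      by rewrite bx invr0 mulr0 sub0r cabsN; left; split => //; exact/b0.
    by rewrite S1E// => h; right; split => // /b0 /eqP; rewrite (negPf bx).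
  case=> [[/b0 -> h]|[nS h]]; first by rewrite invr0 mulr0 sub0r cabsN.
  by rewrite S1E//; apply/eqP => /b0.
apply: measurableU; apply: measurableI => //; last exact: measurableC.
case: (cabs c <= eps).
  by rewrite (_ : [set _ | _] = setT)//; apply/seteqP; split.
by rewrite (_ : [set _ | _] = set0)//; apply/seteqP; split.
Qed.

(** Bias-variance split: [csq (ctop y)] is [csq (ctop y - x)] plus an affine function of [y], whose
    integral is [csq x] because the mean is [x]. *)
Lemma second_moment_le {R : realType} (mu : {measure set (R * R) -> \bar R})
    (x : R[i]) (s : R) :
  mu setT = 1%E ->
  L1 mu fst -> L1 mu snd ->
  (\int[mu]_y (y.1)%:E = (complex.Re x)%:E)%E ->
  (\int[mu]_y (y.2)%:E = (complex.Im x)%:E)%E ->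
  (\int[mu]_y (csq (ctop y - x))%:E <= s%:E)%E ->
  (\int[mu]_y (csq (ctop y))%:E <= (s + csq x)%:E)%E.
Proof.
case: x => a b /= mu1 i1 i2 m1 m2 ms.
have ic (c : R) : L1 mu (cst c).
  apply: measurable_bounded_integrable => //; last exact: bounded_cst.
  by rewrite [X in (X < _)%E]mu1 ltry.
have iV : L1 mu (fun y => csq (ctop y - Complex a b)).
  apply: ge0_L1 ms => [|y]; last exact: csq_ge0.
  by apply: measurable_csq; apply: measurable_funB.
(* Twice the real inner product of [y] with [x], minus the squared modulus of [x]. *)
pose h (y : R * R) := 2 * a * y.1 + 2 * b * y.2 - csq (Complex a b).
have i12 : L1 mu (fun y => 2 * a * y.1 + 2 * b * y.2).
  exact: (L1D _ _ _ (L1Z _ _ _ i1) (L1Z _ _ _ i2)).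
have ih : L1 mu h by exact: (L1B _ _ _ i12 (ic _)).
have hE : \int[mu]_y h y = csq (Complex a b).
  rewrite RintegralB//; last exact: ic.
  rewrite RintegralD//; [|exact: L1Z|exact: L1Z].
  rewrite !RintegralZl// Rintegral_cst//= mu1 /Rintegral m1 m2 /csq /=.
  by ring.
have -> : (\int[mu]_y (csq (ctop y))%:E =
    \int[mu]_y (csq (ctop y - Complex a b))%:E + \int[mu]_y (h y)%:E)%E.
  rewrite -integralD//; apply: eq_integral => y _; rewrite -EFinD; congr EFin.
  by rewrite /h /csq /=; ring.
rewrite EFinD leeD// -(fineK (integrable_fin_num _ ih))//.
by rewrite lee_fin -hE.
Qed.

(** * Mean square error and tail bound of a single estimator *)

Section estimator.
Context {R : realType} {d} {Theta : measurableType d} (P : probability Theta R).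
Context (gamma : Theta -> R) {N : nat} (ph : Theta -> 'cV[R[i]]_N) (O : 'M[R[i]]_N).
Hypothesis mgamma : measurable_fun setT gamma.
Hypothesis mphRe : forall j, measurable_fun setT (fun th => complex.Re (ph th j 0)).
Hypothesis mphIm : forall j, measurable_fun setT (fun th => complex.Im (ph th j 0)).
Hypothesis ph1 : forall th, vnorm (ph th) = 1.
Context (K : R.-pker (Theta * Theta)%type ~> (R * R)%type) (sigma nO : R).
Hypothesis KX : unbiased_with_var K (Xpair gamma ph O) sigma.
Hypothesis XnO : forall z, cabs (Xpair gamma ph O z) <= nO.
Context {dW} {Omega : measurableType dW} (Pr : probability Omega R).

(** Bounds the second moment of one sample; [nO] will be [opnorm O] for the observable and 1 for the
    identity. *)
Let V : R := nO ^+ 2 + sigma ^+ 2.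
Let a : R[i] := expval (psi P gamma ph) O.

Lemma kernel_second_moment_le z : (\int[K z]_y (csq (ctop y))%:E <= V%:E)%E.
Proof.
have [i1 [i2 [m1 [m2 mv]]]] := KX z.
apply: le_trans (second_moment_le (K z) _ _ (prob_kernel z) i1 i2 m1 m2 mv) _.
by rewrite lee_fin /V addrC lerD2r -ler_cabs// (le_trans _ (XnO z))// cabs_ge0.
Qed.

Section sample.
Context (Z : Omega -> (R * R)%type).
Hypothesis mZ : measurable_fun setT Z.
Hypothesis ZK : forall A, measurable A -> Pr (Z @^-1` A) = sample_law P K A.

Let mZ1 : measurable_fun setT (fun w => (Z w).1).
Proof. exact: measurableT_comp mZ. Qed.
Let mZ2 : measurable_fun setT (fun w => (Z w).2).
Proof. exact: measurableT_comp mZ. Qed.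

Lemma sample_second_moment_le : (\int[Pr]_w (csq (ctop (Z w)))%:E <= V%:E)%E.
Proof.
have mc : measurable_fun setT (fun y : R * R => (csq (ctop y))%:E).
  by apply/measurable_EFinP/measurable_csq.
have c0 (y : R * R) : (0 <= (csq (ctop y))%:E)%E by rewrite lee_fin csq_ge0.
rewrite (ge0_integral_law (P \x P)%E K Pr Z mZ ZK _ c0 mc).
apply: (@le_trans _ _ (\int[(P \x P)%E]_z (cst V%:E) z)%E).
  apply: ge0_le_integral => //.
  - by move=> z _; exact: integral_ge0.
  - exact: measurable_integral_ker.
  - by move=> z _; exact: kernel_second_moment_le.
by rewrite integral_cst// [X in (_ * X)%E]probability_setT mule1.
Qed.

Lemma L1_sample_csq : L1 Pr (fun w => csq (ctop (Z w))).
Proof.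
apply: ge0_L1 sample_second_moment_le => [|w]; last exact: csq_ge0.
exact: measurable_csq.
Qed.

Lemma L1_sample_sqr1 : L1 Pr (fun w => (Z w).1 ^+ 2).
Proof.
apply: L1_le L1_sample_csq => [|w]; first exact: measurable_funX.
by rewrite ger0_norm ?sqr_ge0// lerDl sqr_ge0.
Qed.

Lemma L1_sample_sqr2 : L1 Pr (fun w => (Z w).2 ^+ 2).
Proof.
apply: L1_le L1_sample_csq => [|w]; first exact: measurable_funX.
by rewrite ger0_norm ?sqr_ge0// lerDr sqr_ge0.
Qed.

(** Unbiasedness of the kernel evaluates the inner integral as the real part of [Xpair], and
    [cint_Xpair] evaluates the outer one. *)
Lemma Rintegral_sample1 : \int[Pr]_w (Z w).1 = complex.Re a.
Proof.
rewrite /a -cint_Xpair// /= /Rintegral; congr fine.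
apply: (integral_law (P \x P)%E K Pr Z mZ ZK fst) => //.
- exact: (L1_of_sqr _ _ mZ1 L1_sample_sqr1).
- by move=> z; exact: (KX z).1.
- by move=> z; exact: (KX z).2.2.1.
Qed.

Lemma Rintegral_sample2 : \int[Pr]_w (Z w).2 = complex.Im a.
Proof.
rewrite /a -cint_Xpair// /= /Rintegral; congr fine.
apply: (integral_law (P \x P)%E K Pr Z mZ ZK snd) => //.
- exact: (L1_of_sqr _ _ mZ2 L1_sample_sqr2).
- by move=> z; exact: (KX z).2.1.
- by move=> z; exact: (KX z).2.2.2.1.
Qed.

(** The variance is the second moment minus the squared mean; dropping the latter leaves [V]. *)
Lemma sample_variance_le :
  \int[Pr]_w ((Z w).1 - complex.Re a) ^+ 2 +
  \int[Pr]_w ((Z w).2 - complex.Im a) ^+ 2 <= V.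
Proof.
rewrite (Rintegral_sqr_centered _ _ _ mZ1 L1_sample_sqr1 Rintegral_sample1).
rewrite (Rintegral_sqr_centered _ _ _ mZ2 L1_sample_sqr2 Rintegral_sample2).
have : \int[Pr]_w ((Z w).1 ^+ 2) + \int[Pr]_w ((Z w).2 ^+ 2) <= V.
  rewrite -RintegralD//; [|exact: L1_sample_sqr1|exact: L1_sample_sqr2].
  rewrite -lee_fin; apply: le_trans sample_second_moment_le.
  by rewrite /Rintegral fineK//; exact: (integrable_fin_num _ L1_sample_csq).
by have := sqr_ge0 (complex.Re a); have := sqr_ge0 (complex.Im a); lra.
Qed.

End sample.

Section mean.
Context {M : nat} (Z : 'I_M -> Omega -> (R * R)%type).
Hypothesis mZ : forall l, measurable_fun setT (Z l).
Hypothesis indep : mutually_independent Pr Z.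
Hypothesis ZK : forall l A, measurable A -> Pr (Z l @^-1` A) = sample_law P K A.

(** Pairwise independence factorises the integral, and each centred factor has mean 0. It is applied
    with [f] a coordinate projection. *)
Lemma Rintegral_cross0 (f : R * R -> R) (m : R) l k :
  measurable_fun setT f -> (forall l, L1 Pr (fun w => f (Z l w) ^+ 2)) ->
  (forall l, \int[Pr]_w f (Z l w) = m) -> l != k ->
  \int[Pr]_w ((f (Z l w) - m) * (f (Z k w) - m)) = 0.
Proof.
move=> mf f2 fm lk.
have mfZ j : measurable_fun setT (f \o Z j) by exact: measurableT_comp.
have iZ j : L1 Pr (f \o Z j) by exact: (L1_of_sqr _ _ (mfZ j) (f2 j)).
have iC j : L1 Pr ((fun y => f y - m) \o Z j) by exact: (L1B _ _ _ (iZ j) (L1_cst _ _)).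
pose X j : {RV Pr >-> (R * R)%type} :=
  HB.pack (Z j) (isMeasurableFun.Build _ _ _ _ _ (mZ j)).
have mC : measurable_fun setT (fun y => f y - m) by exact: measurable_funB.
have := Rintegral_indep_mul Pr (X l) (X k) _ _
  (fun A B => mutually_independent_pair Pr _ _ _ _ A B indep lk) mC mC (iC l) (iC k).
move=> /= ->.
have -> : \int[Pr]_w (f (Z l w) - m) = 0; last by rewrite mul0r.
rewrite RintegralB//; [|exact: iZ|exact: L1_cst].
by rewrite fm Rintegral_cst//= probability_setT mulr1 subrr.
Qed.

Hypothesis M0 : (0 < M)%N.

Lemma estimatorE w : estimator Z w =
  Complex ((\sum_l (Z l w).1) / M%:R) ((\sum_l (Z l w).2) / M%:R).
Proof.
rewrite /estimator.
have -> : (M%:R : R[i])^-1 = real_complex R (M%:R^-1) by rewrite fmorphV rmorph_nat.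
by apply/eqP; rewrite eq_complex Re_mul Im_mul Re_sum Im_sum /= !mulr0 subr0 add0r mulrC !eqxx.
Qed.

(** Distributes the mean over the [M] terms, so that each coordinate of the error is a sum of
    centred variables as in [Rintegral_sqr_sum]. *)
Lemma estimator_subE w : csq (estimator Z w - a) =
  ((\sum_l ((Z l w).1 - complex.Re a)) ^+ 2 +
   (\sum_l ((Z l w).2 - complex.Im a)) ^+ 2) / M%:R ^+ 2.
Proof.
have Mn0 : M%:R != 0 :> R by rewrite pnatr_eq0 -lt0n.
have sumc (c : R) : \sum_(l < M) c = c * M%:R.
  by rewrite sumr_const card_ord mulr_natr.
by rewrite estimatorE csq_sub !sumrB !sumc /=; field.
Qed.

Lemma measurable_estimator :
  measurable_fun setT (fun w => complex.Re (estimator Z w)) /\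
  measurable_fun setT (fun w => complex.Im (estimator Z w)).
Proof.
split; under eq_fun do rewrite estimatorE /=; apply: measurable_funM => //;
  apply: measurable_sum => l; exact: measurableT_comp (mZ l).
Qed.

Lemma measurable_estimator_sub (b : R[i]) :
  measurable_fun setT (fun w => csq (estimator Z w - b)).
Proof.
have [m1 m2] := measurable_estimator.
under eq_fun do rewrite csq_sub.
by apply: measurable_funD; apply: measurable_funX; exact: measurable_funB.
Qed.

(** With the cross terms gone, [M] sample variances of at most [V] each are divided by
    [M%:R ^+ 2]. *)
Lemma estimator_mse_le :
  (\int[Pr]_w (csq (estimator Z w - a))%:E <= (V / M%:R)%:E)%E.
Proof.
have MR : 0 < M%:R :> R by rewrite ltr0n.
pose Y1 l w := (Z l w).1 - complex.Re a; pose Y2 l w := (Z l w).2 - complex.Im a.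
have mZ1 l : measurable_fun setT (fun w => (Z l w).1) by exact: measurableT_comp (mZ l).
have mZ2 l : measurable_fun setT (fun w => (Z l w).2) by exact: measurableT_comp (mZ l).
have mY1 l : measurable_fun setT (Y1 l) by exact: measurable_funB.
have mY2 l : measurable_fun setT (Y2 l) by exact: measurable_funB.
have q1 l := L1_sample_sqr1 (Z l) (mZ l) (ZK l).
have q2 l := L1_sample_sqr2 (Z l) (mZ l) (ZK l).
have iY1 l : L1 Pr (fun w => Y1 l w ^+ 2) by exact: (L1_sqrB _ _ _ (mZ1 l) (q1 l)).
have iY2 l : L1 Pr (fun w => Y2 l w ^+ 2) by exact: (L1_sqrB _ _ _ (mZ2 l) (q2 l)).
have iS1 := L1_sqr_sum Pr _ Y1 mY1 iY1; have iS2 := L1_sqr_sum Pr _ Y2 mY2 iY2.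
have iS : L1 Pr (fun w => (\sum_l Y1 l w) ^+ 2 + (\sum_l Y2 l w) ^+ 2).
  exact: (L1D _ _ _ iS1 iS2).
have cross1 l k : l != k -> \int[Pr]_w (Y1 l w * Y1 k w) = 0.
  apply: (Rintegral_cross0 fst) => // j.
  exact: Rintegral_sample1 (mZ j) (ZK j).
have cross2 l k : l != k -> \int[Pr]_w (Y2 l w * Y2 k w) = 0.
  apply: (Rintegral_cross0 snd) => // j.
  exact: Rintegral_sample2 (mZ j) (ZK j).
have iE : L1 Pr (fun w => csq (estimator Z w - a)).
  have := L1Z Pr (M%:R ^+ 2)^-1 _ iS.
  by apply: eq_integrable => // w _ /=; rewrite estimator_subE mulrC.
rewrite -(fineK (integrable_fin_num _ iE))// lee_fin -/(Rintegral _ _ _).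
have -> : \int[Pr]_w csq (estimator Z w - a) =
    \int[Pr]_w ((M%:R ^+ 2)^-1 * ((\sum_l Y1 l w) ^+ 2 + (\sum_l Y2 l w) ^+ 2)).
  by apply: eq_Rintegral => w _; rewrite estimator_subE mulrC.
rewrite RintegralZl// RintegralD// !Rintegral_sqr_sum// -big_split /=.
rewrite mulrC ler_pdivrMr ?exprn_gt0//.
have -> : V / M%:R * M%:R ^+ 2 = \sum_(l < M) V.
  by rewrite sumr_const card_ord -mulr_natr; field; rewrite gt_eqF.
by apply: ler_sum => l _; exact: sample_variance_le (mZ l) (ZK l).
Qed.

(** Chebyshev's inequality with squared radius [c]: the hypothesis on [V] says that the mean square
    error is at most [c * k]. *)
Lemma estimator_deviation (c k : R) : 0 <= c -> 0 < k -> V <= c * k * M%:R ->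
  (Pr [set w | c < csq (estimator Z w - a)]%R <= k%:E)%E.
Proof.
move=> c0 k0 Vc; apply: markov_gt => //.
- exact: measurable_estimator_sub.
- by move=> w; exact: csq_ge0.
apply: le_trans estimator_mse_le _; rewrite lee_fin ler_pdivrMr//.
by rewrite ltr0n.
Qed.

End mean.
End estimator.

(** * The ratio of the two estimators *)

Theorem theorem1 (R : realType) (n : nat)
  (dT : measure_display) (Theta : measurableType dT)
  (P : probability Theta R) (gamma : Theta -> R)
  (U : Theta -> 'M[R[i]]_(2 ^ n)) (O : 'M[R[i]]_(2 ^ n))
  (sigmaO sigma1 eps kappa : R) (M : nat)
  (KO K1 : R.-pker (Theta * Theta)%type ~> (R * R)%type)
  (dW : measure_display) (Omega : measurableType dW) (Pr : probability Omega R)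
  (ZO Z1 : 'I_M -> Omega -> (R * R)%type) :
  (* regularity of the parameterised circuit and of the phase *)
  measurable_fun setT gamma ->
  (forall i j, measurable_fun setT (fun th => complex.Re (U th i j))) ->
  (forall i j, measurable_fun setT (fun th => complex.Im (U th i j))) ->
  (forall th, U th \is unitarymx) ->
  (* per-pair measurement procedures: unbiased, variance <= sigma^2 *)
  unbiased_with_var KO (Xpair gamma (phi U) O) sigmaO ->
  unbiased_with_var K1 (Xpair gamma (phi U) 1%:M) sigma1 ->
  (* the M samples of each estimator: independent, each distributed as
     "draw (theta,theta') ~ P x P, then measure" *)
  (forall l, measurable_fun setT (ZO l)) ->
  (forall l, measurable_fun setT (Z1 l)) ->
  mutually_independent Pr ZO ->
  mutually_independent Pr Z1 ->
  (forall l A, measurable A -> Pr (ZO l @^-1` A) = sample_law P KO A) ->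
  (forall l A, measurable A -> Pr (Z1 l @^-1` A) = sample_law P K1 A) ->
  let ps := psi P gamma (phi U) in
  0 < expval ps 1%:M ->
  0 < eps -> 0 < kappa ->
  let chi := Num.sqrt (opnorm O ^+ 2 + sigmaO ^+ 2)
             + Num.sqrt (1 + sigma1 ^+ 2) * opnorm O
             + eps * Num.sqrt (1 + sigma1 ^+ 2) in
  chi ^+ 2 / (kappa * eps ^+ 2 * complex.Re (expval ps 1%:M) ^+ 2) <= M%:R ->
  ((1 - 2 * kappa)%:E <=
     Pr [set w | (cabs (estimator ZO w / estimator Z1 w
                        - expval ps O / expval ps 1%:M) <= eps)%R])%E.
Proof.
move=> mgamma mURe mUIm Uunit KO_ub K1_ub mZO mZ1 indepO indep1 ZOK Z1K ps ps_gt0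
  eps0 kappa0.
set nO := opnorm O; set VO := nO ^+ 2 + sigmaO ^+ 2; set V1 := 1 + sigma1 ^+ 2.
move=> chi; set b0 := complex.Re (expval ps 1%:M) => chiM.
(* [ket0] selects the first column of [U th], so measurability of the entries of [U] passes to the
   state. *)
have phiE th j : phi U th j 0 = U th j (Ordinal (expn_gt0 2 n : (0 < 2 ^ n)%N)).
  rewrite mxE (bigD1 (Ordinal (expn_gt0 2 n : (0 < 2 ^ n)%N)))//= mxE mulr1.
  rewrite big1 ?addr0// => k /negPf k0; rewrite mxE.
  by rewrite -[val k == 0%N]/(k == Ordinal (expn_gt0 2 n : (0 < 2 ^ n)%N)) k0 mulr0.
have mRe j : measurable_fun setT (fun th => complex.Re (phi U th j 0)).
  by under eq_fun do rewrite phiE; exact: mURe.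
have mIm j : measurable_fun setT (fun th => complex.Im (phi U th j 0)).
  by under eq_fun do rewrite phiE; exact: mUIm.
have ph1 th : vnorm (phi U th) = 1 by exact: vnorm_phi.
have nO0 : 0 <= nO by exact: opnorm_ge0.
have b0E : b0 = vnorm ps ^+ 2 by rewrite /b0 expval1.
have b0_gt0 : 0 < b0 by move: ps_gt0; rewrite expval1 b0E ltcR.
have cabsB : cabs (expval ps 1%:M) = b0.
  by rewrite expval1 -b0E /cabs /csq /= expr0n addr0 sqrtr_sqr gtr0_norm.
have cabsA : cabs (expval ps O) <= nO * b0.
  by apply: le_trans (cabs_sesqui_le _ _ _ _) _; rewrite b0E expr2.
have VO0 : 0 <= VO by rewrite addr_ge0 ?sqr_ge0.
have V10 : 0 < V1 by rewrite ltr_pwDl ?sqr_ge0.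
have sV1 : 0 < Num.sqrt V1 by rewrite sqrtr_gt0.
(* The summand [eps * Num.sqrt V1] is positive even when [opnorm O] and [sigmaO] vanish; with the
   sample-size bound this forces [M] to be positive. *)
have chi0 : 0 < chi.
  by rewrite /chi ltr_wpDl ?mulr_gt0// addr_ge0 ?mulr_ge0 ?sqrtr_ge0.
have den0 : 0 < kappa * eps ^+ 2 * b0 ^+ 2 by rewrite !mulr_gt0 ?exprn_gt0.
have M0 : 0 < M%:R :> R by apply: lt_le_trans chiM; rewrite divr_gt0 ?exprn_gt0.
have M0n : (0 < M)%N by rewrite -(ltr0n R).
have kM0 : 0 < kappa * M%:R by rewrite mulr_gt0.
(* With radii [Num.sqrt VO / s] and [Num.sqrt V1 / s], Chebyshev's bound is exactly [kappa] for each
   estimator. *)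
pose s := Num.sqrt (kappa * M%:R).
have s0 : 0 < s by rewrite sqrtr_gt0.
have s2 : s ^+ 2 = kappa * M%:R by rewrite sqr_sqrtr// ltW.
(* The left side is [chi / s], and squaring turns the inequality into the hypothesis on [M]. *)
have budget : Num.sqrt VO / s + Num.sqrt V1 / s * nO + eps * (Num.sqrt V1 / s) <= eps * b0.
  have -> : Num.sqrt VO / s + Num.sqrt V1 / s * nO + eps * (Num.sqrt V1 / s) = chi / s.
    by rewrite /chi; field; rewrite gt_eqF.
  have ebs0 : 0 < eps * b0 * s by rewrite !mulr_gt0.
  rewrite ler_pdivrMr// -ler_sqr ?nnegrE ?(ltW chi0) ?(ltW ebs0)//.
  move: chiM; rewrite ler_pdivrMr// => /le_trans; apply.
  by rewrite exprMn s2 exprMn le_eqVlt; apply/orP; left; apply/eqP; ring.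
pose dO := Num.sqrt VO / s; pose d1 := Num.sqrt V1 / s.
have d10 : 0 < d1 by rewrite divr_gt0.
have dO0 : 0 <= dO by rewrite divr_ge0 ?sqrtr_ge0// ltW.
have dO2 : dO ^+ 2 * kappa * M%:R = VO.
  by rewrite expr_div_n s2 sqr_sqrtr//; field; rewrite !gt_eqF.
have d12 : d1 ^+ 2 * kappa * M%:R = V1.
  by rewrite expr_div_n s2 sqr_sqrtr ?ltW//; field; rewrite !gt_eqF.
pose BO := [set w | dO ^+ 2 < csq (estimator ZO w - expval ps O)]%R.
pose B1 := [set w | d1 ^+ 2 < csq (estimator Z1 w - expval ps 1%:M)]%R.
have PBO : (Pr BO <= kappa%:E)%E.
  apply: (estimator_deviation _ _ _ _ mgamma mRe mIm ph1 _ _ _ KO_ub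
    (cabs_Xpair_le _ _ _ ph1)) => //; first exact: sqr_ge0.
  by rewrite dO2.
have PB1 : (Pr B1 <= kappa%:E)%E.
  apply: (estimator_deviation _ _ _ _ mgamma mRe mIm ph1 _ _ _ K1_ub
    (cabs_Xpair1_le _ _ ph1)) => //; first exact: sqr_ge0.
  by rewrite d12 expr1n.
set G := [set w | _].
have mG : measurable G.
  have [mO1 mO2] := measurable_estimator _ mZO.
  have [m11 m12] := measurable_estimator _ mZ1.
  by apply: measurable_quotient_sub_le => //; exact: ltW.
have mBO : measurable BO by exact/measurable_gt_cst/measurable_estimator_sub.
have mB1 : measurable B1 by exact/measurable_gt_cst/measurable_estimator_sub.
have GB : ~` G `<=` BO `|` B1.
  move=> w; apply: contra_notP => /not_orP[/negP nBO /negP nB1].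
  rewrite /G /=; apply: (cabs_quotient_sub_le _ _ _ _ dO d1 nO b0) => //.
    by rewrite ler_cabs// leNgt.
  by rewrite (ler_cabs _ _ (ltW d10)) leNgt.
(* A union bound, valid whatever the dependence between [ZO] and [Z1]. *)
have PG : (Pr (~` G) <= (2 * kappa)%:E)%E.
  apply: (@le_trans _ _ (Pr (BO `|` B1))).
    by apply: le_measure; rewrite ?inE//; [exact: measurableC|exact: measurableU].
  apply: (@le_trans _ _ (Pr BO + Pr B1)%E); first exact: measureU2.
  by rewrite mulr_natl mulr2n EFinD leeD.
rewrite -(setCK G) probability_setC; last exact: measurableC.
by rewrite EFinB leeB.
Qed.
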